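(* For every integer $d\ge 1$ there is a constant $c_{d}>0$, depending only on $d$, such that for all integers $r\ge 2$ with $r\ge d+1$ and all integers $s\ge 1$, both $$f_{r}(d,s,\ldots,s)\le c_{d}\,r\,s^{r}\log(e\,r\,s^{r})$$ and $$f_{r}(d,s,\ldots,s)\le c_{d}\,r^{d+2}s^{d+1}\log(e\,r\,s)$$ hold.
   Context: A set in $\mathbb{R}^{d}$ is called $s$-convex if it is a union of at most $s$ convex sets. For integers $r\ge 2$, $d\ge 1$ and $s_{1},\ldots,s_{r}\ge 1$, let $f_{r}(d,s_{1},\ldots,s_{r})$ be the least integer $N$ with the following property: whenever $P\subseteq\mathbb{R}^{d}$ is finite and $|P|\ge N$, there is a partition $P=P_{1}\sqcup\cdots\sqcup P_{r}$ into nonempty parts such that every choice of $s_{i}$-convex sets $C_{i}\supseteq P_{i}$, $i\in[r]=\{1,\ldots,r\}$, satisfies $\bigcap_{i=1}^{r}C_{i}\ne\emptyset$. In $f_{r}(d,s,\ldots,s)$ the parameter $s$ is repeated $r$ times. Here $e$ is the base of the natural logarithm. *)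

(* Defs.v *)
From HB Require Import structures.
From mathcomp Require Import all_boot all_order all_algebra finmap.
From mathcomp Require Import boolp classical_sets reals sequences exp convex.

Set Implicit Arguments.
Unset Strict Implicit.
Unset Printing Implicit Defensive.

Import Order.TTheory GRing.Theory Num.Theory.

Local Open Scope classical_set_scope.
Local Open Scope ring_scope.

Definition s_convex (R : realType) (d s : nat) (C : set 'rV[R]_d) : Prop :=
  exists (m : nat) (K : 'I_m -> set 'rV[R]_d),
    [/\ (m <= s)%N,
        forall j, @convex_set R 'rV[R]_d (K j) &
        C = \bigcup_(j in [set: 'I_m]) K j].

(* In the library, [partition D F A] includes that every block [F i], [i] in
   [D], is nonempty. *)
Definition good_partition (R : realType) (d r : nat) (s : 'I_r -> nat)
    (P : set 'rV[R]_d) (B : 'I_r -> set 'rV[R]_d) : Prop :=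
  partition [set: 'I_r] B P /\
  forall C : 'I_r -> set 'rV[R]_d,
    (forall i, s_convex (s i) (C i)) ->
    (forall i, B i `<=` C i) ->
    \bigcap_(i in [set: 'I_r]) C i !=set0.

Definition tverberg_bound (R : realType) (d r : nat) (s : 'I_r -> nat)
    (N : nat) : Prop :=
  forall P : {fset 'rV[R]_d}, (N <= #|` P|)%N ->
    exists B : 'I_r -> set 'rV[R]_d, good_partition s [set` P] B.

(* [is_tverberg_number R d s N] says N = f_r(d, s_1, ..., s_r). It is a relation
   because the existence of a least N is not automatic: asserting a bound on
   f_r(d, s_1, ..., s_r) includes asserting that some N satisfies it. No N < 1
   has the property when r > 0, so ranging over nat loses no integer. *)
Definition is_tverberg_number (R : realType) (d r : nat) (s : 'I_r -> nat)
    (N : nat) : Prop :=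
  tverberg_bound R d s N /\
  forall M : nat, tverberg_bound R d s M -> (N <= M)%N.

(* Main.v *)
Require Import Defs.
From HB Require Import structures.
From mathcomp Require Import all_boot all_order all_algebra finmap.
From mathcomp Require Import boolp classical_sets reals sequences exp convex.
From mathcomp Require Import interval_inference fintype finset ring lra.

Set Implicit Arguments.
Unset Strict Implicit.
Unset Printing Implicit Defensive.

Import Order.TTheory GRing.Theory Num.Theory.

Local Open Scope ring_scope.

(** Colour the n points of P uniformly at random with r colours; a colouring is
    bad if its classes have s-convex covers C_1, ..., C_r, with C_i the union of
    pieces K_(i,1), ..., K_(i,s), whose intersection is empty. The point is that
    badness is witnessed by few data, so that a union bound applies.

    Emptiness of the intersection of the C_i means that for every choice J of
    one piece per colour, the convex sets K_(i,J i) have no common point. By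
    linear duality ([farkas]) and conic Caratheodory, at most d + 1 of them lie
    in closed halfspaces without common point ([empty_hulls_certificate]). Only
    the traces of these halfspaces on P matter, and there are at most
    (n + 1)^(d + 1) traces, by Sauer-Shelah together with Radon's argument
    ([card_halfspace_traces]). Such a cut (d + 1 pieces, one trace for each) is
    needed for all J. Taking one cut for each of the s^r choices J gives the
    first bound. For the second, note that a cut serves every J which selects
    the same d + 1 pieces, so (r s)^(d + 1) cuts suffice.

    A fixed family of D cuts determines regions U_1, ..., U_r with empty
    intersection such that class i lies in U_i. Every point misses some region,
    so at most (r - 1)^n colourings are compatible with the family
    ([card_compatible_colorings]), while the number of families is n^(O_d(D)).
    Hence a colouring which is not bad exists as soon as
    n^(O_d(D)) (1 - 1/r)^n < 1, for which n >= c_d r D log (e r D) is enough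
    ([few_colorings]). *)

(** * Shattering *)

Definition shatters (T : finType) (F : {set {set T}}) (A : {set T}) :=
  [forall B : {set T}, (B \subset A) ==> [exists C in F, C :&: A == B]].

Lemma shattersP (T : finType) (F : {set {set T}}) (A : {set T}) :
  reflect (forall B : {set T}, B \subset A -> exists2 C, C \in F & C :&: A = B)
          (shatters F A).
Proof.
apply: (iffP forallP) => [h B BA|h B].
  by have /implyP/(_ BA)/exists_inP[C CF /eqP CB] := h B; exists C.
by apply/implyP => /h[C CF CB]; apply/exists_inP; exists C => //; apply/eqP.
Qed.

(** Split F by a point x on which two members differ. A set shattered by either
    half avoids x and is shattered by F; if both halves shatter A, then F also
    shatters x |: A, which accounts for the double counting. *)
Lemma card_le_shattered (T : finType) (F : {set {set T}}) :
  (#|F| <= #|[set A | shatters F A]|)%N.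
Proof.
have [n] := ubnP #|F|; elim: n F => // n IHn F /ltnSE leFn.
have [/card_gt1P[B [C [BF CF neqBC]]]|F1] := ltnP 1 #|F|; last first.
  have [->|[C CF]] := set_0Vmem F; first by rewrite cards0.
  apply: leq_trans F1 _; apply/card_gt0P; exists set0; rewrite inE.
  by apply/shattersP => B; rewrite subset0 => /eqP->; exists C; rewrite ?setI0.
have [x xBC] : exists x, (x \in B) != (x \in C).
  apply/existsP; rewrite -negb_forall; apply: contraNN neqBC => /forallP BC.
  by apply/eqP/setP => x; apply/eqP.
pose Fx := [set D : {set T} | x \in D].
have FxE D : (D \in Fx) = (x \in D) by rewrite inE.
have small0 : (#|F :&: Fx| < n)%N.
  apply: leq_trans leFn; apply: proper_card; apply/properP; split.
    exact: subsetIl.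
  case xB: (x \in B) in xBC.
    by exists C; rewrite // inE FxE; case: (x \in C) xBC; rewrite ?andbF.
  by exists B; rewrite // inE FxE xB andbF.
have small1 : (#|F :\: Fx| < n)%N.
  apply: leq_trans leFn; apply: proper_card; apply/properP; split.
    exact: subsetDl.
  case xB: (x \in B) in xBC.
    by exists B; rewrite // inE FxE xB.
  by exists C; rewrite // inE FxE; case: (x \in C) xBC.
have := leq_add (IHn _ small0) (IHn _ small1).
rewrite cardsID -cardsUI; set S1 := [set A | shatters (F :&: Fx) A].
set S0 := [set A | shatters (F :\: Fx) A] => /leq_trans; apply.
have xS1 A : A \in S1 -> x \notin A.
  rewrite inE => /shattersP/(_ _ (sub0set A))[D].
  by rewrite inE FxE => /andP[_ xD] /setP/(_ x); rewrite !inE xD => /= ->.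
have xS0 A : A \in S0 -> x \notin A.
  rewrite inE => /shattersP h; apply/negP => xA.
  have [|D] := h [set x]; first by rewrite sub1set.
  by rewrite inE FxE => /andP[xD _] /setP/(_ x); rewrite !inE eqxx (negPf xD).
have injx : {in S1 :&: S0 &, injective (fun A => x |: A)}.
  move=> A A' /setIP[/xS1 xA _] /setIP[/xS1 xA' _] /(congr1 (fun B => B :\ x)).
  by rewrite !setU1K.
rewrite -(card_in_imset injx) -cardsUI.
rewrite [X in (_ + X)%N](_ : _ = 0)%N ?addn0; last first.
  apply/eqP; rewrite cards_eq0 -subset0; apply/subsetP => A /setIP[AS].
  case/imsetP => A' _ AE; have : x \in A by rewrite AE setU11.
  by case/setUP: AS => [/xS1|/xS0] /negPf->.
apply: subset_leq_card; apply/subsetP => A /setUP[/setUP[]|/imsetP[A' + ->]].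
- rewrite !inE => /shattersP h; apply/shattersP => D /h[E + <-].
  by rewrite inE => /andP[EF _]; exists E.
- rewrite !inE => /shattersP h; apply/shattersP => D /h[E + <-].
  by rewrite inE => /andP[_ EF]; exists E.
move=> /setIP[A'1 A'0]; have xA' := xS1 _ A'1.
move: A'1 A'0; rewrite !inE => /shattersP h1 /shattersP h0.
apply/shattersP => D DA.
have DxA : D :\ x \subset A' by rewrite subDset.
have [xD|xD] := boolP (x \in D).
  have [E] := h1 _ DxA; rewrite inE FxE => /andP[EF xE] EE; exists E => //.
  by rewrite setIUr EE (setIidPr _) ?sub1set// setD1K.
have [E] := h0 _ DxA; rewrite inE FxE => /andP[xE EF] EE; exists E => //.
rewrite setIUr EE (_ : E :&: [set x] = set0) ?set0U.
  by apply/setDidPl; rewrite disjoint_sym disjoints1.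
by apply/setP => y; rewrite !inE; case: eqP => [->|]; rewrite ?andbF ?(negPf xE).
Qed.

(** Only the crude bound on the number of sets of cardinal at most k is wanted:
    they are all obtained from the maps from 'I_k to option T. *)
Lemma sauer_shelah (T : finType) (F : {set {set T}}) (k : nat) :
  (forall A, shatters F A -> (#|A| <= k)%N) -> (#|F| <= #|T|.+1 ^ k)%N.
Proof.
move=> vcF; apply: leq_trans (card_le_shattered F) _.
pose f (g : {ffun 'I_k -> option T}) := [set y | Some y \in codom g].
rewrite -card_option -[k in (_ ^ k)%N]card_ord -card_ffun -cardsT.
apply: leq_trans (leq_imset_card f _).
apply: subset_leq_card; apply/subsetP => A; rewrite inE => /vcF leAk.
apply/imsetP; exists [ffun i : 'I_k => nth None (map Some (enum A)) i] => //.
apply/setP => y; rewrite inE; apply/idP/codomP => [yA|[i]].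
  have lt_i : (index y (enum A) < #|A|)%N by rewrite cardE index_mem mem_enum.
  exists (Ordinal (leq_trans lt_i leAk)); rewrite ffunE (nth_map y) -?cardE//=.
  by rewrite nth_index// mem_enum.
rewrite ffunE; have [lt_i|ge_i] := ltnP i (size (enum A)).
  rewrite (nth_map y)// => -[->]; by rewrite -mem_enum mem_nth.
by rewrite nth_default// size_map.
Qed.

(** * Linear dependence, Farkas' lemma, conic Caratheodory *)

Lemma linear_dependence (R : realFieldType) (T : finType) (m : nat)
    (w : T -> 'rV[R]_m) (A : {set T}) : (m < #|A|)%N ->
  exists nu : T -> R, [/\ forall i, i \notin A -> nu i = 0,
    exists i, 0 < nu i & \sum_i nu i *: w i = 0].
Proof.
move=> ltmA; pose M : 'M[R]_(#|A|, m) := \matrix_k w (enum_val k).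
have /rowV0Pn[v] : kermx M != 0.
  rewrite -mxrank_eq0 mxrank_ker -lt0n subn_gt0.
  exact: leq_ltn_trans (rank_leq_col M) ltmA.
move=> /sub_kermxP vM /rV0Pn[k0 vk0].
pose nu i := \sum_(k | enum_val k == i) v 0 k.
have nuE k : nu (enum_val k) = v 0 k.
  by rewrite /nu (big_pred1 k)// => k'; rewrite (inj_eq enum_val_inj).
have nu0 i : i \notin A -> nu i = 0.
  move=> iA; rewrite /nu big_pred0// => k; apply: contraNF iA => /eqP <-.
  exact: enum_valP.
have sum0 : \sum_i nu i *: w i = 0.
  rewrite -[RHS]vM mulmx_sum_row.
  under eq_bigr do rewrite /nu scaler_suml.
  rewrite (exchange_big_dep xpredT)//=; apply: eq_bigr => k _.
  by rewrite (big_pred1 (enum_val k)) ?rowK// => i; rewrite eq_sym.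
have [/ltW|lt0|/eqP] := ltgtP (v 0 k0) 0; last by rewrite (negPf vk0).
  exists (fun i => - nu i); split => [i /nu0->||]; first by rewrite oppr0.
    by exists (enum_val k0); rewrite nuE oppr_gt0 lt_neqAle vk0.
  by under eq_bigr do rewrite scaleNr; rewrite sumrN sum0 oppr0.
by exists nu; split=> //; exists (enum_val k0); rewrite nuE.
Qed.

(** Bartl's induction. If the last functional a_j cannot be dropped, some z
    satisfies all the other inequalities, violates the conclusion, and has
    a_j z = 1. Projecting along z onto the kernel of a_j removes a_j from the
    system, and undoing the projection only affects the coefficient of a_j. *)
Lemma farkas_seq (R : realFieldType) (V : lmodType R) (J : eqType)
    (s : seq J) (a : J -> V -> R) (g : V -> R) :
  uniq s -> (forall j, scalar (a j)) -> scalar g ->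
  (forall x, (forall j, j \in s -> a j x <= 0) -> g x <= 0) ->
  exists l : J -> R, (forall j, 0 <= l j) /\
    forall x, g x = \sum_(j <- s) l j * a j x.
Proof.
have lin0 (f : V -> R) : scalar f -> f 0 = 0.
  by move=> fL; have := fL 1 0 0; rewrite scaler0 addr0 mul1r; lra.
have linZ (f : V -> R) c x : scalar f -> f (c *: x) = c * f x.
  by move=> fL; have := fL c x 0; rewrite addr0 (lin0 f)// addr0.
elim: s a g => [|j s IHs] a g /=.
  move=> _ _ gL g_le0; exists (fun=> 0); split=> // x; rewrite big_nil.
  apply/eqP; rewrite eq_le g_le0//= -oppr_le0 -mulN1r -linZ//.
  exact: g_le0.
move=> /andP[js us] aL gL g_le0.
have [/IHs[]//|] := pselect (forall x,
    (forall i, i \in s -> a i x <= 0) -> g x <= 0).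
  move=> l [l0 lE]; exists (fun i => if i == j then 0 else l i); split.
    by move=> i; case: ifP.
  move=> x; rewrite big_cons eqxx mul0r add0r lE; apply: eq_big_seq => i si.
  by case: eqP si js => // -> ->.
move=> /existsNP[y /not_implyP[ay /negP]]; rewrite -ltNge => gy.
have ajy : 0 < a j y.
  rewrite ltNge; apply: contraTN gy => ajy; rewrite -leNgt g_le0// => i.
  by rewrite inE => /predU1P[->|/ay].
pose z := (a j y)^-1 *: y.
have ajz : a j z = 1 by rewrite linZ// mulVf// gt_eqF.
have az i : i \in s -> a i z <= 0.
  by move=> /ay aiy; rewrite linZ// mulr_ge0_le0// invr_ge0 ltW.
have gz : 0 <= g z by rewrite linZ// mulr_ge0// ?invr_ge0 ltW.
pose b i x := a i x - a i z * a j x.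
pose h x := g x - g z * a j x.
have bE i x : b i x = a i (- a j x *: z + x).
  by rewrite aL /b; ring.
have hE x : h x = g (- a j x *: z + x) by rewrite gL /h; ring.
have [|||l [l0 lE]] := IHs b h us.
- by move=> i c x x'; rewrite /b !aL; ring.
- by move=> c x x'; rewrite /h aL gL; ring.
- move=> x bx; rewrite hE g_le0// => i; rewrite inE => /predU1P[->|/bx].
    by rewrite aL ajz mulr1 addNr.
  by rewrite bE.
exists (fun i => if i == j then g z - \sum_(i <- s) l i * a i z else l i).
split.
  move=> i; case: eqP => // _; rewrite subr_ge0 (le_trans _ gz)// big_seq.
  by rewrite sumr_le0// => k ks; rewrite mulr_ge0_le0// az.
move=> x; rewrite big_cons eqxx.
rewrite [X in _ + X](eq_big_seq (fun i => l i * a i x)); last first.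
  by move=> i si /=; case: eqP si js => // -> ->.
have := lE x; rewrite /h => /eqP; rewrite subr_eq => /eqP ->.
have -> : \sum_(i <- s) l i * b i x =
    \sum_(i <- s) l i * a i x - (\sum_(i <- s) l i * a i z) * a j x.
  by rewrite mulr_suml -sumrB; apply: eq_bigr => i _; rewrite /b; ring.
ring.
Qed.

Lemma farkas (R : realFieldType) (V : lmodType R) (J : finType)
    (a : J -> V -> R) (g : V -> R) :
  (forall j, scalar (a j)) -> scalar g ->
  (forall x, (forall j, a j x <= 0) -> g x <= 0) ->
  exists l : J -> R, (forall j, 0 <= l j) /\
    forall x, g x = \sum_j l j * a j x.
Proof.
move=> aL gL g_le0; apply: farkas_seq (index_enum_uniq J) aL gL _.
by move=> x ax; apply: g_le0 => j; apply/ax/mem_index_enum.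
Qed.

(** A linear dependence nu on a too large support of mu can be subtracted from
    mu, scaled so that the first coefficient to vanish does so exactly. *)
Lemma conic_caratheodory (R : realFieldType) (T : finType) (m : nat)
    (w : T -> 'rV[R]_m) (mu : T -> R) : (forall i, 0 <= mu i) ->
  exists mu' : T -> R, [/\ forall i, 0 <= mu' i,
    (#|[set i | mu' i != 0%R]| <= m)%N &
    \sum_i mu' i *: w i = \sum_i mu i *: w i].
Proof.
have [N] := ubnP #|[set i | mu i != 0]|.
elim: N mu => // N IHN mu /ltnSE leN mu0.
have [?|ltm] := leqP #|[set i | mu i != 0]| m; first by exists mu.
have [nu [nu0 [k0 nuk0] sum0]] := linear_dependence w ltm.
have [k nuk kmin] := @arg_minP _ _ _ k0 (fun i => 0 < nu i)
  (fun i => mu i / nu i) nuk0.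
(* The largest t with mu - t nu >= 0. *)
pose t := mu k / nu k.
have t0 : 0 <= t by rewrite divr_ge0// ltW.
pose mu1 i := mu i - t * nu i.
have mu1_ge0 i : 0 <= mu1 i.
  rewrite subr_ge0; have [nui|nui] := ltP 0 (nu i).
    by rewrite -ler_pdivlMr//; exact: kmin.
  by apply: le_trans (mu0 i); rewrite mulr_ge0_le0.
have [|mu' [mu'0 mu'm mu'E]] := IHN mu1 _ mu1_ge0.
  apply: leq_trans leN; apply/proper_card/properP; split.
    apply/subsetP => i; rewrite !inE; apply: contraNN => /eqP mui.
    by rewrite /mu1 nu0 ?inE ?mui ?eqxx// mulr0 subr0.
  exists k; rewrite !inE.
    by apply/negP => /eqP muk; rewrite nu0 ?inE ?muk ?eqxx ?ltxx in nuk.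
  by rewrite negbK /mu1 /t divfK ?subrr// gt_eqF.
exists mu'; split=> //; rewrite mu'E /mu1.
under eq_bigr do rewrite scalerBl -scalerA.
by rewrite sumrB -scaler_sumr sum0 scaler0 subr0.
Qed.

(** * Halfspaces and their traces on a finite set *)

(** A point y is lifted to (y, 1), so that a closed halfspace of R^d, or the
    empty set or the whole space, is given by a vector w of R^(d+1) through
    the linear condition that [affine_form w y] is nonpositive. *)
Definition homogenize (R : realFieldType) (d : nat) (y : 'rV[R]_d) :
  'rV[R]_(d + 1) := row_mx y 1%:M.

Definition affine_form (R : realFieldType) (d : nat) (w : 'rV[R]_(d + 1))
  (y : 'rV[R]_d) : R := (w *m (homogenize y)^T) 0 0.

Lemma affine_form_scalar (R : realFieldType) (d : nat) (y : 'rV[R]_d) :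
  scalar (@affine_form R d ^~ y).
Proof. by move=> a w w'; rewrite /affine_form mulmxDl -scalemxAl !mxE. Qed.

Lemma affine_form_sum (R : realFieldType) (d : nat) (y : 'rV[R]_d)
    (T : finType) (mu : T -> R) (w : T -> 'rV[R]_(d + 1)) :
  affine_form (\sum_i mu i *: w i) y = \sum_i mu i * affine_form (w i) y.
Proof.
rewrite /affine_form mulmx_suml summxE; apply: eq_bigr => i _.
by rewrite -scalemxAl mxE.
Qed.

Lemma affine_formE (R : realFieldType) (d : nat) (w : 'rV[R]_(d + 1))
    (y : 'rV[R]_d) :
  affine_form w y = \sum_k w 0 (lshift 1 k) * y 0 k + w 0 (rshift d 0).
Proof.
rewrite /affine_form mxE big_split_ord /= big_ord1.
congr (_ + _); last by rewrite [X in _ * X]mxE row_mxEr mxE mulr1.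
by apply: eq_bigr => k _; rewrite [X in _ * X]mxE row_mxEl.
Qed.

Definition halfspace_trace (R : realFieldType) (d : nat) (T : finType)
  (x : T -> 'rV[R]_d) (w : 'rV[R]_(d + 1)) : {set T} :=
  [set k | affine_form w (x k) <= 0].

(** Radon's argument. More than d + 1 lifted points carry a linear dependence nu
    with a positive coefficient. A halfspace cutting out exactly the points with
    nu k <= 0 makes every term nu k * affine_form w (x k) nonnegative and one of
    them positive, although they add up to 0. *)
Lemma halfspace_trace_vc (R : realFieldType) (d : nat) (T : finType)
    (x : T -> 'rV[R]_d) (F : {set {set T}}) (A : {set T}) :
  (forall B, B \in F -> exists w, B = halfspace_trace x w) ->
  shatters F A -> (#|A| <= d + 1)%N.
Proof.
move=> FH /shattersP shA; rewrite leqNgt; apply/negP.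
move=> /(linear_dependence (fun k => homogenize (x k))).
move=> [nu [nu0 [k0 nuk0] sum0]].
have sum_form w : \sum_k nu k * affine_form w (x k) = 0.
  transitivity ((w *m (\sum_k nu k *: homogenize (x k))^T) 0 0).
    rewrite linear_sum mulmx_sumr summxE; apply: eq_bigr => k _.
    by rewrite linearZ/= -scalemxAr mxE.
  by rewrite sum0 trmx0 mulmx0 mxE.
have k0A : k0 \in A by apply: contraTT nuk0 => /nu0 ->; rewrite ltxx.
have [|B /FH[w ->]] := shA [set k in A | nu k <= 0].
  by apply/subsetP => k; rewrite inE => /andP[].
move=> /setP BE.
have signs k : k \in A -> (affine_form w (x k) <= 0) = (nu k <= 0).
  by move=> kA; have := BE k; rewrite !inE kA andbT /= => ->.
suff : 0 < \sum_k nu k * affine_form w (x k) by rewrite sum_form ltxx.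
rewrite (bigD1 k0)//=; apply: ltr_pwDl.
  by rewrite mulr_gt0// ltNge signs// -ltNge.
apply: sumr_ge0 => k _.
have [kA|/nu0 ->] := boolP (k \in A); last by rewrite mul0r.
have [nuk|nuk] := ltP 0 (nu k).
  by rewrite mulr_ge0// ltW// ltNge signs// -ltNge.
by rewrite mulr_le0// signs.
Qed.

Definition halfspace_traces (R : realFieldType) (d : nat) (T : finType)
  (x : T -> 'rV[R]_d) : {set {set T}} :=
  [set B | `[< exists w, B = halfspace_trace x w >]].

Lemma card_halfspace_traces (R : realFieldType) (d : nat) (T : finType)
    (x : T -> 'rV[R]_d) :
  (#|halfspace_traces x| <= #|T|.+1 ^ (d + 1))%N.
Proof.
apply: sauer_shelah => A; apply: (halfspace_trace_vc (x := x)) => B.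
by rewrite inE => /asboolP.
Qed.

(** * Separating hulls without common point *)

Definition in_hull (R : realFieldType) (d : nat) (T : finType)
    (x : T -> 'rV[R]_d) (A : {set T}) (y : 'rV[R]_d) :=
  exists l : T -> R, [/\ forall k, 0 <= l k, forall k, k \notin A -> l k = 0,
    \sum_k l k = 1 & \sum_k l k *: x k = y].

(** The hulls have a common point iff a linear system in the convex coefficients
    is solvable; this is its dual. The unknown of the dual system is the family
    of vectors w i. The constraints are that w i is nonpositive on the points of
    Q i and that the linear parts of the w i add up to 0 (two inequalities for
    each coordinate), and the form to be made positive is the sum of the
    constant parts. If it cannot be, the multipliers of the first constraints
    are convex coefficients in every Q i, and those of the others give minus the
    common point. *)
Lemma empty_hulls_separated (R : realFieldType) (d : nat) (I T : finType)
    (x : T -> 'rV[R]_d) (Q : I -> {set T}) :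
  ~ (exists y, forall i, in_hull x (Q i) y) ->
  exists w : I -> 'rV[R]_(d + 1),
    (forall i k, k \in Q i -> affine_form (w i) (x k) <= 0) /\
    forall y, 0 < affine_form (\sum_i w i) y.
Proof.
move=> Q0.
(* The coordinate of the constant part. *)
pose lastc : 'I_(d + 1) := rshift d 0.
pose V := {ffun I -> 'rV[R]_(d + 1)}.
pose a (j : (I * T) + ('I_d * bool)) (W : V) : R := match j with
  | inl (i, k) => if k \in Q i then affine_form (W i) (x k) else 0
  | inr (t, b) => (-1) ^+ b * (\sum_i W i) 0 (lshift 1 t) end.
pose g (W : V) : R := (\sum_i W i) 0 lastc.
have sumL c (u v : V) :
    \sum_i (c *: u + v) i = c *: (\sum_i u i) + \sum_i v i.
  by rewrite scaler_sumr -big_split; apply: eq_bigr => i _; rewrite !ffunE.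
have aL j : scalar (a j).
  case: j => [[i k]|[t b]] c u v /=.
    by rewrite !ffunE affine_form_scalar; case: ifP => // _; rewrite mulr0 addr0.
  by rewrite sumL !mxE; ring.
have gL : scalar g by move=> c u v; rewrite /g sumL !mxE.
have [g_le0|] := pselect (forall W, (forall j, a j W <= 0) -> g W <= 0).
  case: Q0; have [l [l0 lE]] := farkas aL gL g_le0.
  pose mu t := l (inr (t, false)) - l (inr (t, true)).
  exists (\row_t - mu t) => i.
  pose lam k := if k \in Q i then l (inl (i, k)) else 0.
  (* The identity of farkas, read on the matrix unit in row i and column c. *)
  have lamE c : (c == lastc)%:R = \sum_k lam k * homogenize (x k) 0 c +
      \sum_t mu t * (lshift 1 t == c)%:R.
    pose W : V := [ffun i' => if i' == i then delta_mx 0 c else 0].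
    have sumW : \sum_i' W i' = delta_mx 0 c.
      rewrite (bigD1 i)//= ffunE eqxx big1 ?addr0// => i' /negPf ii'.
      by rewrite ffunE ii'.
    have := lE W; rewrite /g sumW mxE eqxx eq_sym => ->.
    rewrite big_sumType /=; congr (_ + _).
      transitivity (\sum_i' \sum_k l (inl (i', k)) * a (inl (i', k)) W).
        by rewrite pair_bigA; apply: eq_bigr => -[].
      rewrite /= (bigD1 i)//= [X in _ + X]big1 ?addr0; last first.
        move=> i' /negPf ii'; rewrite big1// => k _; rewrite ffunE ii'.
        by rewrite /affine_form mul0mx mxE if_same mulr0.
      apply: eq_bigr => k _; rewrite ffunE eqxx /lam; case: ifP => _.
        rewrite /affine_form -rowE; congr (_ * _); by rewrite !mxE.
      by rewrite mulr0 mul0r.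
    transitivity (\sum_t \sum_b l (inr (t, b)) * a (inr (t, b)) W).
      by rewrite pair_bigA; apply: eq_bigr => -[].
    apply: eq_bigr => t _; rewrite big_bool /= sumW !mxE eqxx /= /mu.
    by rewrite expr0 expr1; ring.
  exists lam; split.
  - by move=> k; rewrite /lam; case: ifP.
  - by move=> k /negPf kQ; rewrite /lam kQ.
  - have e := lamE lastc; rewrite eqxx in e; apply: etrans (esym e).
    rewrite [X in _ + X]big1 ?addr0 => [|t _].
      apply: eq_bigr => k _.
      by rewrite /homogenize /lastc row_mxEr mxE eqxx mulr1.
    by rewrite eq_lrshift mulr0.
  apply/rowP => t; rewrite summxE mxE; apply/eqP.
  rewrite -addr_eq0; apply/eqP.
  have e := lamE (lshift 1 t); rewrite eq_lrshift in e.
  apply: etrans (esym e).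
  congr (_ + _).
    by apply: eq_bigr => k _; rewrite mxE /homogenize row_mxEl.
  rewrite (bigD1 t)//= eqxx mulr1 big1 ?addr0// => t' /negPf tt'.
  by rewrite (inj_eq (@lshift_inj _ _)) tt' mulr0.
move=> /existsNP[W /not_implyP[aW /negP]]; rewrite -ltNge => gW.
exists W; split=> [i k kQ|y]; first by have := aW (inl (i, k)); rewrite /= kQ.
rewrite affine_formE big1 ?add0r// => t _.
rewrite (_ : _ 0 (lshift 1 t) = 0) ?mul0r//; apply/eqP; rewrite eq_le.
have := aW (inr (t, false)); have := aW (inr (t, true)) => /=.
by rewrite expr0 expr1 mul1r mulN1r oppr_le0 => -> ->.
Qed.

(** This plays the role of Helly's theorem. The sum of the w i is a positive
    constant form in a space of dimension d + 1, and Caratheodory writes it with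
    at most d + 1 of the w i, which then cannot all be nonpositive at one point.
    The map f lists their indices, padded with i0. *)
Lemma empty_hulls_certificate (R : realFieldType) (d : nat) (I T : finType)
    (x : T -> 'rV[R]_d) (Q : I -> {set T}) (i0 : I) :
  ~ (exists y, forall i, in_hull x (Q i) y) ->
  exists (w : I -> 'rV[R]_(d + 1)) (f : {ffun 'I_(d + 1) -> I}),
    (forall i k, k \in Q i -> affine_form (w i) (x k) <= 0) /\
    forall y, exists l, 0 < affine_form (w (f l)) y.
Proof.
move=> /empty_hulls_separated[w [wQ w_gt0]].
have [mu [mu0 muS muE]] := conic_caratheodory w (mu := fun=> 1) (fun=> ler01).
set S := [set i | _] in muS.
exists w, [ffun l : 'I__ => nth i0 (enum S) l]; split=> // y.
have [i [iS wi]] : exists i, i \in S /\ 0 < affine_form (w i) y.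
  apply: contrapT => /forallNP wS; have := w_gt0 y; rewrite ltNge => /negP.
  apply; under eq_bigr do rewrite -[w _]scale1r.
  rewrite -muE affine_form_sum sumr_le0// => i _.
  have [->|mui] := eqVneq (mu i) 0; first by rewrite mul0r.
  rewrite mulr_ge0_le0// leNgt; apply/negP => wi; apply: (wS i).
  by rewrite inE.
have lt_i : (index i (enum S) < d + 1)%N.
  by apply: leq_trans muS; rewrite cardE index_mem mem_enum.
by exists (Ordinal lt_i); rewrite ffunE nth_index// mem_enum.
Qed.

Lemma convex_set_sum (R : realType) (d : nat) (K : set 'rV[R]_d) (T : finType)
    (x : T -> 'rV[R]_d) (l : T -> R) : @convex_set R 'rV[R]_d K ->
  (forall k, 0 <= l k) -> (forall k, l k != 0 -> K (x k)) ->
  \sum_k l k = 1 -> K (\sum_k l k *: x k).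
Proof.
move=> cK; have [n] := ubnP #|[set k | l k != 0]|.
elim: n l => // n IHn l /ltnSE len l0 lK l1.
have [k0 lk0] : exists k, l k != 0.
  apply: contrapT => /forallNP all0; have /eqP := l1.
  by rewrite big1 ?(eq_sym 0) ?oner_eq0// => k _; apply/eqP/negPn/negP/all0.
have rest0 : 0 <= \sum_(k | k != k0) l k by rewrite sumr_ge0.
move: (l1); rewrite (bigD1 k0)//= => sumE.
have lk1 : l k0 <= 1 by rewrite -sumE lerDl.
have [lk0_1|lk0_n1] := eqVneq (l k0) 1.
  have rest_eq0 : \sum_(k | k != k0) l k = 0 by lra.
  rewrite (bigD1 k0)//= lk0_1 scale1r big1 ?addr0; first exact: lK.
  move=> k kk0; rewrite (psumr_eq0P _ rest_eq0) ?scale0r//.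
have d0 : 0 < 1 - l k0 by rewrite subr_gt0 lt_neqAle lk0_n1.
pose l' k := if k == k0 then 0 else l k / (1 - l k0).
have l'E : \sum_k l' k = 1.
  rewrite (bigD1 k0)//= /l' eqxx add0r.
  rewrite (eq_bigr (fun k => l k / (1 - l k0))) => [|k /negPf ->//].
  rewrite -mulr_suml (_ : \sum_(k | k != k0) l k = 1 - l k0); last by lra.
  by rewrite divff// gt_eqF.
have Ky : K (\sum_k l' k *: x k).
  apply: IHn => // [|k|k].
  - apply: leq_trans len; apply/proper_card/properP; split.
      apply/subsetP => k; rewrite !inE /l'; case: (k == k0).
        by rewrite eqxx.
      by apply: contraNN => /eqP ->; rewrite mul0r.
    by exists k0; rewrite !inE /l' ?eqxx ?lk0.
  - by rewrite /l'; case: ifP => // _; rewrite divr_ge0// ltW.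
  rewrite /l'; case: (k == k0) => h; first by rewrite eqxx in h.
  by apply: lK; apply: contraNN h => /eqP ->; rewrite mul0r.
have /set_mem := cK _ _ (Itv01 (l0 k0) lk1) (mem_set (lK _ lk0)) (mem_set Ky).
rewrite /conv/=; congr K.
rewrite [RHS](bigD1 k0)//=; congr (_ + _).
rewrite (bigD1 k0)//= {1}/l' eqxx scale0r add0r scaler_sumr.
apply: eq_bigr => k /negPf kk0; rewrite /l' kk0 scalerA; congr (_ *: _).
exact: etrans (mulrC _ _) (divfK (lt0r_neq0 d0) _).
Qed.

Lemma in_hull_convex_set (R : realType) (d : nat) (K : set 'rV[R]_d)
    (T : finType) (x : T -> 'rV[R]_d) (A : {set T}) (y : 'rV[R]_d) :
  @convex_set R 'rV[R]_d K -> (forall k, k \in A -> K (x k)) ->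
  in_hull x A y -> K y.
Proof.
move=> cK AK [l [l0 lA l1 <-]]; apply: convex_set_sum => // k lk.
by apply: AK; apply: contraNT lk => /lA ->.
Qed.

(** * Counting colourings with a certificate *)

Lemma card_compatible_colorings (T : finType) (r : nat) (U : 'I_r -> {set T}) :
  (forall k, exists i, k \notin U i) ->
  (#|[set chi : {ffun T -> 'I_r} | [forall k, k \in U (chi k)]]|
     <= r.-1 ^ #|T|)%N.
Proof.
move=> U0; rewrite cardsE.
rewrite (@eq_card _ _ (family (fun k => [pred i | k \in U i]))) => [|chi].
  rewrite card_family foldrE big_image /= -prod_nat_const.
  apply: leq_prod => k _; have [i kUi] := U0 k.
  rewrite -[r in (_ <= r.-1)%N]card_ord -(cardC1 i) subset_leq_card//.
  by apply/subsetP => j; rewrite !inE; apply: contraTneq => ->.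
by rewrite !inE; apply/forallP/familyP.
Qed.

(** A list of m pieces, each given by a colour and an index in 'I_s, together
    with a member of H for each; H names the halfspace traces, through a map ev
    into subsets of T. *)
Definition piece_cut (m r s : nat) (H : finType) : Type :=
  ({ffun 'I_m -> 'I_r} * {ffun 'I_m -> 'I_s} * {ffun 'I_m -> H})%type.

(** The traces are outer approximations of the pieces, fine enough to show that
    no choice J of one piece per colour has a common point. *)
Definition certifies (m r s : nat) (H T D : finType) (ev : H -> {set T})
    (Q : 'I_r -> 'I_s -> {set T}) (t : D -> piece_cut m r s H) : Prop :=
  (forall e l, Q ((t e).1.1 l) ((t e).1.2 l) \subset ev ((t e).2 l)) /\
  (forall J : {ffun 'I_r -> 'I_s}, exists e,
     (forall l, J ((t e).1.1 l) = (t e).1.2 l) /\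
     forall k, exists l, k \notin ev ((t e).2 l)).

(** The outer approximation of the union of the pieces of colour i: piece j is
    replaced with the intersection of all traces attached to (i, j). *)
Definition region (m r s : nat) (H T D : finType) (ev : H -> {set T})
    (t : D -> piece_cut m r s H) (i : 'I_r) : {set T} :=
  [set k | [exists j, [forall e, forall l,
    ((t e).1.1 l == i) && ((t e).1.2 l == j) ==> (k \in ev ((t e).2 l))]]].

Lemma certifies_sub_region (m r s : nat) (H T D : finType) (ev : H -> {set T})
    (Q : 'I_r -> 'I_s -> {set T}) (t : D -> piece_cut m r s H) i j :
  certifies ev Q t -> Q i j \subset region ev t i.
Proof.
move=> [tQ _]; apply/subsetP => k kQ; rewrite inE; apply/existsP; exists j.
apply/'forall_forallP => e l; apply/implyP => /andP[/eqP ei /eqP ej].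
by apply: subsetP (tQ e l) _ _; rewrite ei ej.
Qed.

(** A point k of all regions selects in every colour i a piece J i whose
    approximation contains k; the cut which treats J excludes k. *)
Lemma certifies_region_empty (m r s : nat) (H T D : finType)
    (ev : H -> {set T}) (Q : 'I_r -> 'I_s -> {set T}) (t : D -> piece_cut m r s H)
    (k : T) :
  certifies ev Q t -> exists i, k \notin region ev t i.
Proof.
move=> [_ tJ]; apply/existsP; rewrite -negb_forall; apply/negP => /forallP kU.
have /fin_all_exists[J JU] i : exists j, [forall e, forall l,
    ((t e).1.1 l == i) && ((t e).1.2 l == j) ==> (k \in ev ((t e).2 l))].
  by apply/existsP; have := kU i; rewrite inE.
have [e [eJ /(_ k)[l /negP]]] := tJ (finfun J); apply.
have /'forall_forallP/(_ e l)/implyP := JU ((t e).1.1 l); apply.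
by rewrite -eJ ffunE !eqxx.
Qed.

(** The union bound: the left-hand side bounds the number of families of cuts
    times the number of colourings compatible with one of them. *)
Lemma exists_uncertified_coloring (m r s : nat) (H T D : finType)
    (ev : H -> {set T}) :
  ((r ^ m * s ^ m * #|H| ^ m) ^ #|D| * r.-1 ^ #|T| < r ^ #|T|)%N ->
  exists chi : {ffun T -> 'I_r}, forall (Q : 'I_r -> 'I_s -> {set T})
    (t : D -> piece_cut m r s H),
    (forall k, exists j, k \in Q (chi k) j) -> ~ certifies ev Q t.
Proof.
move=> few.
pose code := {ffun D -> piece_cut m r s H}.
pose sound (t : code) := [forall k, exists i, k \notin region ev t i].
pose compat (t : code) :=
  [set chi : {ffun T -> 'I_r} | [forall k, k \in region ev t (chi k)]].
pose bad := \bigcup_(t | sound t) compat t.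
have card_bad : (#|bad| < #|{ffun T -> 'I_r}|)%N.
  rewrite card_ffun card_ord; apply: leq_ltn_trans few.
  have -> : ((r ^ m * s ^ m * #|H| ^ m) ^ #|D| = #|{: code}|)%N.
    by rewrite card_ffun !card_prod !card_ffun !card_ord.
  rewrite -sum_nat_const.
  apply: (@leq_trans (\sum_(t | sound t) #|compat t|)%N).
    rewrite /bad; elim/big_rec2: _ => [|t n A _ leA]; first by rewrite cards0.
    apply: (leq_trans (leq_card_setU _ _).1).
    by rewrite leq_add2l.
  rewrite big_mkcond; apply: leq_sum => t _; case: ifP => // /'forall_existsP st.
  exact: card_compatible_colorings.
have [chi chi_bad] : exists chi, chi \notin bad.
  apply/existsP; rewrite -negb_forall; apply: contraTN card_bad => /forallP all.
  by rewrite -leqNgt subset_leq_card//; apply/subsetP.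
exists chi => Q t chiQ tQ; case/negP: chi_bad; apply/bigcupP.
have regE : region ev (finfun t : code) =1 region ev t.
  move=> i; apply/setP => k; rewrite !inE; apply: eq_existsb => j.
  by do 2!apply: eq_forallb => ?; rewrite ffunE.
exists (finfun t).
  apply/'forall_existsP => k; have [i] := certifies_region_empty k tQ.
  by rewrite -regE; exists i.
rewrite inE; apply/forallP => k; rewrite regE; have [j] := chiQ k.
exact/subsetP/certifies_sub_region.
Qed.

(** * The two families of cuts *)

Definition trace_of (R : realFieldType) (d : nat) (T : finType)
    (x : T -> 'rV[R]_d) (h : {A | A \in halfspace_traces x}) : {set T} := sval h.

Lemma certificate_by_choices (R : realFieldType) (d r s : nat) (T : finType)
    (x : T -> 'rV[R]_d) (Q : 'I_r -> 'I_s -> {set T}) :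
  (forall J : 'I_r -> 'I_s, ~ exists y, forall i, in_hull x (Q i (J i)) y) ->
  (0 < r)%N ->
  exists t : {ffun 'I_r -> 'I_s} ->
             piece_cut (d + 1) r s {A | A \in halfspace_traces x},
    certifies (@trace_of R d T x) Q t /\
    forall J : {ffun 'I_r -> 'I_s}, (forall l, J ((t J).1.1 l) = (t J).1.2 l) /\
      forall k, exists l, k \notin trace_of ((t J).2 l).
Proof.
move=> Q_disjoint r0.
suff /fin_all_exists[t tP] (J : {ffun 'I_r -> 'I_s}) :
    exists t1 : piece_cut (d + 1) r s {A | A \in halfspace_traces x},
    [/\ forall l, Q (t1.1.1 l) (t1.1.2 l) \subset trace_of (t1.2 l),
        forall l, J (t1.1.1 l) = t1.1.2 l &
        forall k, exists l, k \notin trace_of (t1.2 l)].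
  exists t; split=> [|J]; last by have [] := tP J.
  by split=> [e l|J]; [have [] := tP e | exists J; have [] := tP J].
have [w [f [wQ fP]]] := empty_hulls_certificate (Ordinal r0) (Q_disjoint J).
have inH l : halfspace_trace x (w (f l)) \in halfspace_traces x.
  by rewrite inE; apply/asboolP; exists (w (f l)).
exists (f, [ffun l => J (f l)],
        [ffun l => exist _ (halfspace_trace x (w (f l))) (inH l)]).
split=> [l|l|k] /=; rewrite ?ffunE//.
  by apply/subsetP => k /wQ; rewrite /trace_of /= inE.
have [l wl] := fP (x k); exists l.
by rewrite ffunE /trace_of/= inE -ltNge.
Qed.

(** Cuts for two choices J and J' which use the same pieces are interchangeable,
    so one cut for each pattern of d + 1 pieces suffices. A pattern which does
    not occur receives the cut of an arbitrary choice J0. *)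
Lemma certificate_by_patterns (R : realFieldType) (d r s : nat) (T : finType)
    (x : T -> 'rV[R]_d) (Q : 'I_r -> 'I_s -> {set T}) :
  (forall J : 'I_r -> 'I_s, ~ exists y, forall i, in_hull x (Q i (J i)) y) ->
  (0 < r)%N -> (0 < s)%N ->
  exists t : {ffun 'I_(d + 1) -> 'I_r} * {ffun 'I_(d + 1) -> 'I_s} ->
             piece_cut (d + 1) r s {A | A \in halfspace_traces x},
    certifies (@trace_of R d T x) Q t.
Proof.
move=> Q_disjoint r0 s0.
have [t [[tQ _] tJ]] := certificate_by_choices Q_disjoint r0.
pose J0 : {ffun 'I_r -> 'I_s} := [ffun=> Ordinal s0].
pose pick_of p := odflt J0 [pick J | (t J).1 == p].
exists (t \o pick_of); split=> [e l|J]; first exact: tQ.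
exists (t J).1.
rewrite /= /pick_of; case: pickP => [J' /eqP eJ' /=|/(_ J)]; last by rewrite eqxx.
have [tJ1 _] := tJ J; have [_ tJ2] := tJ J'.
by split=> // l; rewrite eJ' tJ1.
Qed.

(** * The size at which colourings outnumber certificates *)

Lemma ln_le_tangent (R : realType) (y K : R) : 0 < y -> 0 < K ->
  ln y <= y / K + ln K - 1.
Proof.
move=> y0 K0; have yK : 0 < y / K by rewrite divr_gt0.
have -> : ln y = ln (y / K) + ln K.
  by rewrite -lnM ?posrE// divfK// gt_eqF.
rewrite addrAC lerD2r; have := @le_ln1Dx _ (y / K - 1).
by rewrite addrCA subrr addr0; apply; lra.
Qed.

Lemma ln_ge1 (R : realType) (X : R) : 1 <= X -> 1 <= ln (expR 1 * X).
Proof.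
move=> X1; rewrite -[X in X <= _](expRK 1) ler_ln ?posrE ?expR_gt0//.
  by rewrite ler_peMr// expR_ge0.
by rewrite mulr_gt0 ?expR_gt0//; lra.
Qed.

(** Bounding (1 - 1/r)^n by exp (- n/r), the claim is a D ln (n + 1) < n / r.
    With K = 2 a r D, the tangent of ln at K bounds the left-hand side by
    (n + 1) / (2 r) + a D (ln K - 1), and this is less than n / r because the
    hypothesis reads n >= K (ln K + 1). *)
Lemma few_colorings (R : realType) (a D r n : nat) :
  (0 < a)%N -> (0 < D)%N -> (1 < r)%N ->
  2 * a%:R * (r * D)%:R * (ln (2 * a%:R) + ln (expR 1 * (r * D)%:R))
    <= n%:R :> R ->
  (n.+1 ^ (a * D) * r.-1 ^ n < r ^ n)%N.
Proof.
move=> a0 D0 r1 le_n.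
have r0 : 0 < r%:R :> R by rewrite ltr0n ltnW.
have a1 : 1 <= a%:R :> R by rewrite ler1n.
have D1 : 1 <= D%:R :> R by rewrite ler1n.
pose K : R := 2 * a%:R * (r%:R * D%:R).
have X0 : 0 < r%:R * D%:R :> R by rewrite mulr_gt0// ltr0n.
have K2 : 2 < K.
  have r2 : 2 <= r%:R :> R by rewrite ler_nat.
  have : 2 <= r%:R * D%:R :> R by nra.
  by rewrite /K; nra.
have K0 : 0 < K by lra.
have {}le_n : K * (ln K + 1) <= n%:R.
  apply: le_trans le_n; rewrite natrM -/K le_eqVlt; apply/orP; left.
  rewrite [ln (expR 1 * _)]lnM ?posrE ?expR_gt0// expRK addrCA.
  rewrite -lnM ?posrE//; last by lra.
  by rewrite -/K addrC.
have ln_n := @ln_le_tangent _ n.+1%:R K (ltr0Sn _ _) K0.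
have lt_exp : (a * D)%:R * ln n.+1%:R < n%:R / r%:R :> R.
  rewrite ltr_pdivlMr// -mulrA mulrC -mulrA.
  have -> : ln n.+1%:R * (r%:R * (a * D)%:R) = K / 2 * ln n.+1%:R :> R.
    by rewrite natrM /K; field.
  apply: (@le_lt_trans _ _ (K / 2 * (n.+1%:R / K + ln K - 1))).
    by rewrite ler_pM2l//; lra.
  have -> : K / 2 * (n.+1%:R / K + ln K - 1) =
      (n%:R + 1) / 2 + K / 2 * (ln K - 1) :> R.
    by rewrite -natr1; field; rewrite gt_eqF.
  by nra.
rewrite -(ltr_nat R) natrM !natrX.
have rE : r.-1%:R = r%:R * (1 - r%:R^-1) :> R.
  rewrite mulrBr mulr1 divff ?gt_eqF// -[in RHS](prednK (ltnW r1)) -natr1.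
  by rewrite addrK.
rewrite rE exprMn mulrCA -[X in _ < X]mulr1 ltr_pM2l ?exprn_gt0//.
have rV1 : 0 <= 1 - r%:R^-1 :> R.
  by rewrite subr_ge0 invf_le1// ler1n ltnW.
apply: (@le_lt_trans _ _ (n.+1%:R ^+ (a * D) * expR (- r%:R^-1) ^+ n)).
  by rewrite ler_wpM2l ?exprn_ge0// lerXn2r ?nnegrE ?expR_ge0// expR_ge1Dx.
rewrite -[n.+1%:R]lnK ?posrE ?ltr0Sn// -!expRM_natl -expRD.
rewrite -[X in _ < X]expR0 ltr_expR.
by rewrite mulrN subr_lt0.
Qed.

(** * From colourings to Tverberg partitions *)

Lemma exists_hull_coloring (R : realFieldType) (d r s D : nat) (T : finType)
    (x : T -> 'rV[R]_d) : (0 < r)%N -> (0 < s)%N ->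
  D = (s ^ r)%N \/ D = ((r * s) ^ (d + 1))%N -> (r * s <= #|T|.+1)%N ->
  (#|T|.+1 ^ ((d + 1) * (d + 2) * D) * r.-1 ^ #|T| < r ^ #|T|)%N ->
  exists chi : {ffun T -> 'I_r}, forall Q : 'I_r -> 'I_s -> {set T},
    (forall k, exists j, k \in Q (chi k) j) ->
    exists (J : 'I_r -> 'I_s) y, forall i, in_hull x (Q i (J i)) y.
Proof.
move=> r0 s0 DE le_rs few.
have D0 : (0 < D)%N by case: DE => ->; rewrite expn_gt0 ?muln_gt0 ?r0 s0.
have few_cuts : ((r ^ (d + 1) * s ^ (d + 1) *
    #|{: {A | A \in halfspace_traces x}}| ^ (d + 1)) ^ D * r.-1 ^ #|T|
      < r ^ #|T|)%N.
  apply: leq_ltn_trans few; rewrite leq_mul2r; apply/orP; right.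
  rewrite expnM leq_exp2r//.
  rewrite -!expnMn [((d + 1) * _)%N]mulnC expnM leq_exp2r ?addn1//.
  by rewrite addn2 expnS leq_mul// card_sig -[d.+1]addn1 card_halfspace_traces.
have [chi chiP] : exists chi : {ffun T -> 'I_r},
    forall Q : 'I_r -> 'I_s -> {set T},
    (forall k, exists j, k \in Q (chi k) j) ->
    ~ forall J : 'I_r -> 'I_s, ~ exists y, forall i, in_hull x (Q i (J i)) y.
  case: DE => DE.
    have [|chi chiP] := @exists_uncertified_coloring (d + 1) r s _ _
      {ffun 'I_r -> 'I_s} (@trace_of R d T x).
      by rewrite card_ffun !card_ord -DE.
    exists chi => Q chiQ QJ.
    have [t [tQ _]] := certificate_by_choices QJ r0.
    exact: chiP chiQ tQ.
  have [|chi chiP] := @exists_uncertified_coloring (d + 1) r s _ _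
    ({ffun 'I_(d + 1) -> 'I_r} * {ffun 'I_(d + 1) -> 'I_s})%type
    (@trace_of R d T x).
    by rewrite card_prod !card_ffun !card_ord; rewrite DE (expnMn r s) in few_cuts.
  exists chi => Q chiQ QJ.
  have [t tQ] := certificate_by_patterns QJ r0 s0.
  exact: chiP chiQ tQ.
exists chi => Q /chiP QJ; apply: contrapT => noJ; apply: QJ => J [y yP].
by apply: noJ; exists J, y.
Qed.

(** Pieces beyond the actual number m <= s are taken to be empty. *)
Lemma s_convexP (R : realType) (d s : nat) (C : set 'rV[R]_d) :
  s_convex s C -> exists K : 'I_s -> set 'rV[R]_d,
    (forall j, @convex_set R 'rV[R]_d (K j)) /\
    forall y, C y <-> exists j, K j y.
Proof.
move=> [m [K [le_ms cK ->]]].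
exists (fun j => [set y | exists2 j' : 'I_m, j' = j :> nat & K j' y]%classic).
split=> [j|y].
  move=> y z l /set_mem[j1 j1j Ky] /set_mem[j2 j2j Kz]; apply/mem_set.
  exists j1 => //; have ? : j1 = j2 by apply: ord_inj; rewrite j1j j2j.
  by subst j2; apply/set_mem/cK; apply/mem_set.
split=> [[j _ Ky]|[j [j' _ Ky]]]; last by exists j'.
by exists (widen_ord le_ms j); exists j.
Qed.

Lemma s_convex0 (R : realType) (d s : nat) :
  s_convex s (@classical_sets.set0 'rV[R]_d).
Proof.
exists 0%N, (fun=> classical_sets.set0); split=> //; first by case.
by apply/classical_sets.seteqP; split=> // y [[]].
Qed.

Lemma s_convexT (R : realType) (d s : nat) :
  (0 < s)%N -> s_convex s (@classical_sets.setT 'rV[R]_d).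
Proof.
move=> s0; exists 1%N, (fun=> classical_sets.setT); split=> //.
  by move=> _ y z l _ _; apply/mem_set.
by apply/classical_sets.seteqP; split=> // y _; exists ord0.
Qed.

(** The intersection property makes every class nonempty: an empty class i could
    be covered by the empty set and the other ones by the whole space. *)
Lemma good_partition_coloring (R : realType) (d r s : nat)
    (P : {fset 'rV[R]_d}) (chi : {ffun P -> 'I_r}) :
  (1 < r)%N -> (0 < s)%N ->
  (forall Q : 'I_r -> 'I_s -> {set P},
    (forall k, exists j, k \in Q (chi k) j) ->
    exists (J : 'I_r -> 'I_s) y, forall i, in_hull val (Q i (J i)) y) ->
  good_partition (fun=> s) [set` P]%classic
    (fun i => [set y | exists2 k : P, chi k = i & val k = y]%classic).
Proof.
move=> r1 s0 hullP; set B := (X in good_partition _ _ X).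
have meet (C : 'I_r -> set 'rV[R]_d) : (forall i, s_convex s (C i)) ->
    (forall i, B i `<=` C i)%classic -> exists y, forall i, C i y.
  move=> sC BC; have [K KP] := choice (fun i => s_convexP (sC i)).
  have [|J [y yP]] := hullP (fun i j => [set k | `[< K i j (val k) >]]).
    move=> k; have /(KP _).2[j Kj] : C (chi k) (val k) by apply: BC; exists k.
    by exists j; rewrite inE; apply/asboolP.
  exists y => i; apply/(KP i).2; exists (J i).
  apply: in_hull_convex_set ((KP i).1 _) _ (yP i) => k.
  by rewrite inE => /asboolP.
split; last first.
  move=> C sC BC; have [y Cy] := meet C sC BC.
  by exists y => i _; exact: Cy.
split.
- apply/classical_sets.seteqP; split=> [y [i _ [k _ <-]]|y yP]; first exact: valP.
  by exists (chi [`yP]%fset) => //; exists [`yP]%fset.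
- move=> i j _ _ [y [[k <- ky] [k' <- k'y]]]; congr (chi _).
  by apply: val_inj; rewrite ky.
move=> i _; apply/classical_sets.set0P/negP => /eqP Bi0.
pose C j := if j == i then classical_sets.set0 else @classical_sets.setT 'rV[R]_d.
have [j||y /(_ i)] := meet C.
- by rewrite /C; case: eqP => _; [exact: s_convex0 | exact: s_convexT].
- move=> j; rewrite /C; case: eqP => [->|_ y //]; by rewrite Bi0.
by rewrite /C eqxx.
Qed.

(** The choice of the pieces of the cuts is absorbed in the powers of n + 1
    because r s <= r D <= n, the first inequality from s <= D. *)
Lemma tverberg_bound_of_cuts (R : realType) (d r s D N : nat) :
  (1 < r)%N -> (0 < s)%N ->
  D = (s ^ r)%N \/ D = ((r * s) ^ (d + 1))%N ->
  2 * ((d + 1) * (d + 2))%:R * (r * D)%:R *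
    (ln (2 * ((d + 1) * (d + 2))%:R) + ln (expR 1 * (r * D)%:R)) <= N%:R :> R ->
  @tverberg_bound R d r (fun=> s) N.
Proof.
move=> r1 s0 DE leN P leNP; have r0 := ltnW r1.
have le_sD : (s <= D)%N.
  case: DE => ->; first by rewrite -[X in (X <= _)%N]expn1 leq_pexp2l.
  rewrite -[X in (X <= _)%N]expn1 (leq_trans (leq_pexp2l s0 (leq_addl d 1)))//.
  by rewrite leq_exp2r ?addn1// leq_pmull.
have D0 : (0 < D)%N by apply: leq_trans le_sD.
set a := ((d + 1) * (d + 2))%N in leN *.
have a0 : (0 < a)%N by rewrite muln_gt0 !addnS.
have {}leN : 2 * a%:R * (r * D)%:R *
    (ln (2 * a%:R) + ln (expR 1 * (r * D)%:R)) <= #|{: P}|%:R :> R.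
  by rewrite (le_trans leN)// ler_nat -cardfE.
have a1 : 1 <= a%:R :> R by rewrite ler1n.
have X1 : 1 <= (r * D)%:R :> R by rewrite ler1n muln_gt0 r0.
have [|chi chiP] :=
    exists_hull_coloring (val : P -> 'rV[R]_d) r0 s0 DE _
      (few_colorings a0 D0 r1 leN).
  rewrite (leq_trans (leq_mul (leqnn r) le_sD))// ltnW// ltnS -(ler_nat R).
  apply: le_trans leN.
  have la : 0 <= ln (2 * a%:R) :> R by rewrite ln_ge0//; lra.
  have lX : 1 <= ln (expR 1 * (r * D)%:R) :> R := ln_ge1 X1.
  rewrite -[X in X <= _]mulr1 ler_pM//.
    by rewrite ler_peMl//; lra.
  by lra.
by eexists; exact: good_partition_coloring chiP.
Qed.

Lemma exists_tverberg_number (R : realType) (d r : nat) (s : 'I_r -> nat)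
    (M : nat) : tverberg_bound R d s M ->
  exists2 N, is_tverberg_number R d s N &
    forall M', tverberg_bound R d s M' -> (N <= M')%N.
Proof.
move=> MP.
have exM : exists N, `[< tverberg_bound R d s N >] by exists M; apply/asboolP.
case: (ex_minnP exM) => N /asboolP NP Nmin.
have {}Nmin M' : tverberg_bound R d s M' -> (N <= M')%N.
  by move=> M'P; apply: Nmin; apply/asboolP.
by exists N.
Qed.

Lemma tverberg_bound_log (R : realType) (d r s D : nat) :
  (1 < r)%N -> (0 < s)%N ->
  D = (s ^ r)%N \/ D = ((r * s) ^ (d + 1))%N ->
  exists2 N, @tverberg_bound R d r (fun=> s) N &
    N%:R <= (2 * ((d + 1) * (d + 2))%:R *
               (ln (2 * ((d + 1) * (d + 2))%:R) + 1) + 1) *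
            (r%:R * D%:R) * ln (expR 1 * (r%:R * D%:R)) :> R.
Proof.
move=> r1 s0 DE; have r0 := ltnW r1.
have D0 : (0 < D)%N by case: DE => ->; rewrite expn_gt0 ?muln_gt0 ?r0 s0.
have X1 : 1 <= (r * D)%:R :> R by rewrite ler1n muln_gt0 r0.
pose A : R := 2 * ((d + 1) * (d + 2))%:R.
have A2 : 2 <= A by rewrite /A ler_peMr// ler1n muln_gt0 !addnS.
have lA : 0 <= ln A by rewrite ln_ge0//; lra.
rewrite -/A -natrM; set X : R := (r * D)%:R in X1 *.
have lX : 1 <= ln (expR 1 * X) := ln_ge1 X1.
exists (Num.truncn (A * X * (ln A + ln (expR 1 * X)))).+1.
  exact: tverberg_bound_of_cuts DE (ltW (truncnS_gt _)).
rewrite -natr1; set L := ln (expR 1 * X) in lX *.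
have XL : 1 <= X * L by nra.
have AX : 0 <= A * X by nra.
have z0 : 0 <= A * X * (ln A + L) by rewrite mulr_ge0//; lra.
apply: (@le_trans _ _ (A * X * (ln A + L) + 1)).
  by rewrite lerD2r truncn_le.
have -> : (A * (ln A + 1) + 1) * X * L =
    A * X * (ln A + L) + X * L + A * X * (ln A * (L - 1)) by ring.
have : 0 <= A * X * (ln A * (L - 1)) by rewrite !mulr_ge0//; lra.
by lra.
Qed.

Theorem mainTheorem8 (R : realType) (d : nat) (d_ge1 : (1 <= d)%N) :
  exists c : R, 0 < c /\
    forall r s : nat, (2 <= r)%N -> (d + 1 <= r)%N -> (1 <= s)%N ->
      exists N : nat,
        [/\ is_tverberg_number R d (fun _ : 'I_r => s) N,
            N%:R <= c * r%:R * s%:R ^+ r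
                      * ln (expR 1 * r%:R * s%:R ^+ r) &
            N%:R <= c * r%:R ^+ (d + 2) * s%:R ^+ (d + 1)
                      * ln (expR 1 * r%:R * s%:R)].
Proof.
pose A : R := 2 * ((d + 1) * (d + 2))%:R.
pose c0 : R := A * (ln A + 1) + 1.
have A2 : 2 <= A by rewrite /A ler_peMr// ler1n muln_gt0 !addnS.
have lA : 0 <= ln A by rewrite ln_ge0//; lra.
have c0_gt0 : 0 < c0 by rewrite ltr_wpDl// mulr_ge0//; lra.
have c_le : c0 <= (d + 2)%:R * c0.
  by apply: ler_peMl; [exact: ltW | rewrite ler1n addnS].
exists ((d + 2)%:R * c0); split; first by rewrite mulr_gt0// ltr0n addnS.
move=> r s r1 _ s0; have r0 := ltnW r1.
have r1R : 1 <= r%:R :> R by rewrite ler1n.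
have s1R : 1 <= s%:R :> R by rewrite ler1n.
have rs1 : 1 <= r%:R * s%:R :> R by rewrite mulr_ege1.
have [N1 N1P N1le] := @tverberg_bound_log R d _ _ _ r1 s0 (or_introl erefl).
have [N2 N2P N2le] := @tverberg_bound_log R d _ _ _ r1 s0 (or_intror erefl).
have [N NP Nmin] := exists_tverberg_number N1P.
exists N; split=> //.
  apply: (@le_trans _ _ N1%:R); first by rewrite ler_nat Nmin.
  apply: le_trans N1le _; rewrite -/A -/c0 natrX -[expR 1 * _ * _]mulrA.
  rewrite -[_ * r%:R * _]mulrA; set X := r%:R * s%:R ^+ r.
  have X1 : 1 <= X by rewrite mulr_ege1// exprn_ege1.
  apply: ler_wpM2r; first by have := ln_ge1 X1; lra.
  by apply: ler_wpM2r => //; lra.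
apply: (@le_trans _ _ N2%:R); first by rewrite ler_nat Nmin.
apply: le_trans N2le _; rewrite -/A -/c0 natrX natrM.
set X := r%:R * (r%:R * s%:R) ^+ (d + 1).
have XE : X = r%:R ^+ (d + 2) * s%:R ^+ (d + 1).
  by rewrite /X exprMn mulrA -exprS addn1 addn2.
have X1 : 1 <= X by rewrite mulr_ege1// exprn_ege1.
have lnX : ln (expR 1 * X) <= (d + 2)%:R * ln (expR 1 * (r%:R * s%:R)).
  rewrite mulr_natl -lnXn ?mulr_gt0 ?expR_gt0//; [|lra|lra].
  have e1 : 1 <= expR 1 :> R by have := @expR_ge1Dx R 1; lra.
  rewrite ler_ln ?posrE ?mulr_gt0 ?exprn_gt0 ?mulr_gt0 ?expR_gt0//; try lra.
  rewrite exprMn; apply: ler_pM; [exact: expR_ge0|lra| |].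
    by rewrite addnS exprS ler_peMr ?expR_ge0// exprn_ege1.
  rewrite /X addn2 addn1 [_ ^+ d.+2]exprS ler_wpM2r ?exprn_ge0 ?mulr_ge0//.
  by rewrite ler_peMr.
rewrite -[_ * c0 * _ * _]mulrA -XE -[expR 1 * _ * _]mulrA.
rewrite -mulrA [leRHS](_ : _ =
  c0 * (X * ((d + 2)%:R * ln (expR 1 * (r%:R * s%:R))))); last by ring.
by rewrite ler_pM2l// ler_pM2l//; lra.
Qed.
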